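(* Let $X$ be an arbitrary set and let $(A,\Omega,+,1)\in\mathcal{S}_{\mathcal{V}_1}$. Each mapping $h\colon X\to A$ can be extended to a unique homomorphism $\overline{\overline{h}}\colon(\mathcal{P}_{>0}^{<\omega}F_{\mathcal{V}_1}(X),\Omega,\cup,\{1\})\to(A,\Omega,+,1)$ such that $\overline{\overline{h}}|_X=h$, where each $x\in X$ is identified with the singleton $\{x\}$.
   Context: Fix a finitary type $\Omega$ in which all operations have positive arity ($\Omega$ may be infinite), and adjoin a constant symbol $1$. An element $1$ of an algebra $(A,\Omega)$ is a unit if for every $n$-ary $\omega\in\Omega$ and every $x\in A$, $\omega(x,1,\ldots,1)=\omega(1,x,1,\ldots,1)=\cdots=\omega(1,\ldots,1,x)=x$. Let $\mathcal{V}_1$ be a variety of algebras $(A,\Omega,1)$ in which the distinguished constant $1$ is a unit. $(F_{\mathcal{V}_1}(X),\Omega,1)$ is the free algebra over $X$ in $\mathcal{V}_1$. A semilattice ordered $\mathcal{V}_1$-algebra with a unit is an algebra $(A,\Omega,+,1)$ with $(A,\Omega,1)\in\mathcal{V}_1$, $(A,+)$ a (join) semilattice, and each $\omega\in\Omega$ distributing over $+$ in each argument: $\omega(x_1,\ldots,x_i+y_i,\ldots,x_n)=\omega(x_1,\ldots,x_i,\ldots,x_n)+\omega(x_1,\ldots,y_i,\ldots,x_n)$. It is not assumed that $1$ is the greatest element of $(A,+)$. $\mathcal{S}_{\mathcal{V}_1}$ is the variety of all semilattice ordered $\mathcal{V}_1$-algebras with a unit. $\mathcal{P}_{>0}^{<\omega}B$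 is the set of all finite non-empty subsets of $B$, with complex operations $\omega(B_1,\ldots,B_n)=\{\omega(b_1,\ldots,b_n)\mid b_i\in B_i\}$ and set union $\cup$. *)

(* Defs.v *)
From mathcomp Require Import all_boot.
From mathcomp Require Import boolp classical_sets functions cardinality.

Set Implicit Arguments.
Unset Strict Implicit.
Unset Printing Implicit Defensive.

Local Open Scope classical_set_scope.

Record signature := Signature {
  op :> Type;
  arity : op -> nat;
  arity_gt0 : forall w, 0 < arity w }.

(* Algebras of type (Omega, 1) and of type (Omega, +, 1): no axioms yet. *)
Record algebra (S : signature) := Algebra {
  carrier :> Type;
  app : forall w : S, ('I_(arity w) -> carrier) -> carrier;
  one : carrier }.

Record add_algebra (S : signature) := AddAlgebra {
  reduct :> algebra S;
  add : reduct -> reduct -> reduct }.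

Arguments app {S} a w _.
Arguments one {S} a.
Arguments add {S} a _ _.

Definition upd (T : Type) (n : nat) (t : 'I_n -> T) (i : 'I_n) (x : T) : 'I_n -> T :=
  fun j => if j == i then x else t j.

Section Algebras.
Variable S : signature.

Definition is_hom (A B : algebra S) (f : A -> B) : Prop :=
  f (one A) = one B /\
  forall (w : S) (t : 'I_(arity w) -> A), f (app A w t) = app B w (fun i => f (t i)).

Definition is_add_hom (A B : add_algebra S) (f : A -> B) : Prop :=
  is_hom f /\ forall x y, f (add A x y) = add B (f x) (f y).

Inductive term (X : Type) : Type :=
| Var of X
| One
| App (w : S) of ('I_(arity w) -> term X).

Fixpoint eval (X : Type) (A : algebra S) (v : X -> A) (u : term X) : A :=
  match u with
  | Var x => v x
  | One => one A
  | App w us => app A w (fun i => eval v (us i))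
  end.

Definition satisfies (A : algebra S) (X : Type) (e : term X * term X) : Prop :=
  forall v : X -> A, eval v e.1 = eval v e.2.

(* Operations being finitary, countably many variables suffice. *)
Definition is_variety (V : algebra S -> Prop) : Prop :=
  exists E : set (term nat * term nat),
    forall A, V A <-> forall e, E e -> satisfies A e.

Definition is_unit (A : algebra S) (a : A) : Prop :=
  forall (w : S) (i : 'I_(arity w)) (x : A), app A w (upd (fun=> a) i x) = x.

Definition unital_variety (V : algebra S -> Prop) : Prop :=
  is_variety V /\ forall A, V A -> is_unit (one A).

Definition is_free (V : algebra S -> Prop) (X : Type) (F : algebra S)
    (eta : X -> F) : Prop :=
  V F /\
  forall B : algebra S, V B -> forall h : X -> B,
    exists! g : F -> B, is_hom g /\ forall x, g (eta x) = h x.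

Definition is_semilattice (T : Type) (add : T -> T -> T) : Prop :=
  [/\ associative add, commutative add & idempotent_op add].

Definition distributes (A : add_algebra S) : Prop :=
  forall (w : S) (t : 'I_(arity w) -> A) (i : 'I_(arity w)) (x y : A),
    app A w (upd t i (add A x y)) =
    add A (app A w (upd t i x)) (app A w (upd t i y)).

Definition semilattice_ordered (V : algebra S -> Prop) (A : add_algebra S) : Prop :=
  [/\ V A, is_semilattice (add A) & distributes A].

End Algebras.

Definition fin_subset (T : Type) : Type := {B : set T | finite_set B /\ B !=set0}.

Lemma fin1_proof (T : Type) (x : T) : finite_set [set x] /\ [set x] !=set0.
Proof. by split; [exact: finite_set1 | exists x]. Qed.

Definition fin1 (T : Type) (x : T) : fin_subset T := exist _ [set x] (fin1_proof x).

Lemma finU_proof (T : Type) (B C : fin_subset T) :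
  finite_set (sval B `|` sval C) /\ (sval B `|` sval C) !=set0.
Proof.
case: B C => [B [Bf [x Bx]]] [C [Cf _]] /=; split; last by exists x; left.
by rewrite finite_setU.
Qed.

Definition finU (T : Type) (B C : fin_subset T) : fin_subset T :=
  exist _ (sval B `|` sval C) (finU_proof B C).

Lemma finite_box (T : Type) (n : nat) (B : 'I_n -> set T) :
  (forall i, finite_set (B i)) -> finite_set [set t : 'I_n -> T | forall i, B i (t i)].
Proof.
elim: n B => [|n IHn] B Bf.
  have [->|/set0P [t0 _]] := eqVneq [set t : 'I_0 -> T | forall i, B i (t i)] set0.
    exact: finite_set0.
  apply: sub_finite_set (finite_set1 t0) => t _ /=.
  by apply/funext; case.
pose cons_fun (p : T * ('I_n -> T)) (i : 'I_n.+1) : T :=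
  if unlift ord0 i is Some j then p.2 j else p.1.
have Cf := IHn _ (fun j => Bf (lift ord0 j)).
apply: sub_finite_set (finite_image cons_fun (finite_setX (Bf ord0) Cf)).
move=> t Bt; exists (t ord0, fun j => t (lift ord0 j)) => /=.
  by split=> //= j; apply: Bt.
apply/funext => i; rewrite /cons_fun.
by case: unliftP => [j|] ->.
Qed.

Lemma complex_op_proof (S : signature) (F : algebra S) (w : S)
    (B : 'I_(arity w) -> fin_subset F) :
  let C := [set app F w t | t in [set t | forall i, sval (B i) (t i)]] in
  finite_set C /\ C !=set0.
Proof.
split.
  apply: finite_image; apply: (@finite_box F _ (fun i => sval (B i))) => i.
  by case: (svalP (B i)).
have /choice [t Bt] : forall i, exists x, sval (B i) x.
  by move=> i; case: (svalP (B i)).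
by exists (app F w t), t.
Qed.

Definition complex_op (S : signature) (F : algebra S) (w : S)
    (B : 'I_(arity w) -> fin_subset F) : fin_subset F :=
  exist _ [set app F w t | t in [set t | forall i, sval (B i) (t i)]]
    (complex_op_proof B).

Definition power_algebra (S : signature) (F : algebra S) : add_algebra S :=
  @AddAlgebra S (Algebra (@complex_op S F) (fin1 (one F))) (@finU F).

(* Main.v *)
Require Import Defs.
From mathcomp Require Import all_boot.
From mathcomp Require Import boolp classical_sets functions cardinality.

Set Implicit Arguments.
Unset Strict Implicit.
Unset Printing Implicit Defensive.

(** The free algebra [F] gives a homomorphism [k : F -> A] extending [h], and
    every finite non-empty set is a finite union of singletons.  Hence the only
    candidate for the extension sends [B] to the join in [A] of the elements
    [k b], [b] in [B]; conversely, any two homomorphisms extending [h] agree on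
    singletons, by freeness of [F] applied to their composites with [fin1], and
    so agree everywhere by induction on [B] ([fin_subset_ind]).

    What has to be checked is that taking joins is compatible with the complex
    operations, that is, that an operation of [A] applied to finite joins is the
    join of its values over the box of all choices of arguments ([app_is_sup]).
    One argument at a time, this says that an additive map preserves finite
    non-empty joins ([additive_is_sup]); the arguments are then replaced in turn.

    Joins are described by their universal property [is_sup] rather than as
    iterated sums, so that repetitions and the order of summation never matter:
    the values of two joins are compared by comparing their upper bounds. *)

Lemma fin_subset_eq (T : Type) (B C : fin_subset T) : sval B = sval C -> B = C.
Proof. by case: B C => [B HB] [C HC] /= BC; apply: eq_exist. Qed.

Lemma fin_subset_ind (T : Type) (P : fin_subset T -> Prop) :
  (forall x, P (fin1 x)) ->
  (forall x B, P B -> P (finU (fin1 x) B)) ->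
  forall B, P B.
Proof.
move=> P1 PU B.
have /finite_seqP [s Es] : finite_set (sval B : set {classic T}).
  by case: (svalP B).
elim: s B Es => [|x s IHs] B Es.
  by have [_ [y]] := svalP B; rewrite Es.
have [s0|s0] := pselect ([set` s] !=set0)%classic; last first.
  rewrite (_ : B = fin1 x) //; apply: fin_subset_eq; rewrite Es /=.
  apply/seteqP; split=> y /=; rewrite inE; last by move=> ->; rewrite eqxx.
  by case/orP => [/eqP //|ys]; case: s0; exists y.
pose C : fin_subset T := exist _ _ (conj (finite_seq s) s0).
rewrite (_ : B = finU (fin1 x) C); first exact/PU/IHs.
apply: fin_subset_eq; rewrite Es; apply/seteqP; split=> y /=; rewrite inE.
  by case/orP => [/eqP|]; [left | right].
by case=> [->|->]; rewrite ?eqxx ?orbT.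
Qed.

Section Joins.
Variables (L : Type) (join : L -> L -> L).
Hypothesis joinP : is_semilattice join.

Let below (a b : L) : Prop := join a b = b.

Definition is_sup (I : Type) (P : set I) (k : I -> L) (a : L) : Prop :=
  forall u, below a u <-> forall i, P i -> below (k i) u.

Lemma is_sup_unique (I : Type) (P : set I) (k : I -> L) (a b : L) :
  is_sup P k a -> is_sup P k b -> a = b.
Proof.
have [_ joinC joinI] := joinP => Ha Hb.
have ab : below a b by apply/Ha/Hb; apply: joinI.
have ba : below b a by apply/Hb/Ha; apply: joinI.
by rewrite -ba joinC.
Qed.

Lemma below_join a b u : below (join a b) u <-> below a u /\ below b u.
Proof.
have [joinA joinC joinI] := joinP; rewrite /below; split=> [<-|[au bu]].
  by split; rewrite !joinA ?joinI // (joinC b a) -(joinA a b b) joinI.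
by rewrite -joinA bu au.
Qed.

Lemma is_sup1 (I : Type) (x : I) (k : I -> L) : is_sup (sval (fin1 x)) k (k x).
Proof. by move=> u; split=> [ku i -> //|]; apply. Qed.

Lemma is_supU (I : Type) (B C : fin_subset I) (k : I -> L) (a b : L) :
  is_sup (sval B) k a -> is_sup (sval C) k b ->
  is_sup (sval (finU B C)) k (join a b).
Proof.
move=> Ha Hb u; rewrite below_join (Ha u) (Hb u); split=> [[HB HC] i [/HB|/HC] //|H].
by split=> i Hi; apply: H; [left | right].
Qed.

Lemma is_sup_exists (I : Type) (B : fin_subset I) (k : I -> L) :
  exists a, is_sup (sval B) k a.
Proof.
elim/fin_subset_ind: B => [x|x B [a Ha]]; first by exists (k x); apply: is_sup1.
by exists (join (k x) a); apply: is_supU => //; apply: is_sup1.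
Qed.

(** By uniqueness, a join over a finite non-empty set is an iterated sum of
    values at singletons, which additive maps preserve.  Non-emptiness matters:
    an additive map need not preserve a least element. *)
Lemma additive_is_sup (I : Type) (B : fin_subset I) (k : I -> L) (f : L -> L) a :
  (forall x y, f (join x y) = join (f x) (f y)) ->
  is_sup (sval B) k a -> is_sup (sval B) (fun i => f (k i)) (f a).
Proof.
move=> fD; elim/fin_subset_ind: B a => [x|x B IHB] a Ha.
  by rewrite (is_sup_unique Ha (is_sup1 x k)); apply: (is_sup1 x (fun i => f (k i))).
have [b Hb] := is_sup_exists B k.
rewrite (is_sup_unique Ha (is_supU (is_sup1 x k) Hb)) fD.
by apply: is_supU; [apply: (is_sup1 x (fun i => f (k i))) | apply: IHB].
Qed.

End Joins.

Section Operations.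
Variables (S : signature) (A : add_algebra S).
Hypotheses (addP : is_semilattice (add A)) (appD : distributes A).

Lemma upd_self (T : Type) (n : nat) (t : 'I_n -> T) (i : 'I_n) : upd t i (t i) = t.
Proof. by apply/funext => j; rewrite /upd; case: eqP => [->|]. Qed.

(** The upper bounds of the values of [w] stay the same when the first [m]
    arguments [k (c i)] are replaced by the joins [a i]: passing from [m] to
    [m.+1] changes one argument, in which [w] is additive. *)
Lemma app_is_sup (I : Type) (w : S) (B : 'I_(arity w) -> fin_subset I)
    (k : I -> A) (a : 'I_(arity w) -> A) :
  (forall i, is_sup (add A) (sval (B i)) k (a i)) ->
  is_sup (add A) [set c | forall i, sval (B i) (c i)]%classic
    (fun c => app A w (fun i => k (c i))) (app A w a).
Proof.
move=> Ha u.
pose mix m (c : 'I_(arity w) -> I) (i : 'I_(arity w)) :=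
    if i < m then a i else k (c i).
pose bounded m := forall c, (forall i, sval (B i) (c i)) ->
  add A (app A w (mix m c)) u = u.
have mix_upd c (i : 'I_(arity w)) x : mix i (upd c i x) = upd (mix i.+1 c) i (k x).
  apply/funext => j; rewrite /mix /upd ltnS.
  have [->|ne_ji] := eqVneq j i; first by rewrite ltnn.
  by rewrite [in RHS]leq_eqVlt (inj_eq val_inj) (negPf ne_ji).
have bounded_step (i : 'I_(arity w)) : bounded i.+1 <-> bounded i.
  have Hi c := additive_is_sup addP (f := fun x => app A w (upd (mix i.+1 c) i x))
                 (appD (mix i.+1 c) i) (Ha i).
  have mixS c : upd (mix i.+1 c) i (a i) = mix i.+1 c.
    by rewrite -[a i](_ : mix i.+1 c i = _) ?upd_self // /mix ltnSn.
  split=> H c Hc.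
    rewrite -(upd_self c i) mix_upd.
    by apply: (Hi c u).1 => //; rewrite mixS; apply: H.
  (* Adding up over the [i]-th argument the bounds given by [H] for all choices. *)
  rewrite -mixS; apply/(Hi c u) => x Bx; rewrite -mix_upd; apply: H => j.
  by rewrite /upd; case: eqP => [->|].
have bounded0 m : m <= arity w -> bounded m <-> bounded 0.
  elim: m => [//|m IHm] lt_m.
  exact: iff_trans (bounded_step (Ordinal lt_m)) (IHm (ltnW lt_m)).
(* The box is non-empty, so that [bounded (arity w)] really bounds [app A w a]. *)
have /choice [c0 Hc0] : forall i, exists x, sval (B i) x.
  by move=> i; case: (svalP (B i)).
have mix_all c : mix (arity w) c = a by apply/funext => i; rewrite /mix ltn_ord.
apply: iff_trans (bounded0 _ (leqnn _)); split=> [H c _|/(_ c0 Hc0)].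
  by rewrite mix_all.
by rewrite mix_all.
Qed.

End Operations.

(** Together with the case of [1], this makes the singletons a copy of [F] inside
    its power algebra, on which freeness of [F] can be used. *)
Lemma complex_op_fin1 (S : signature) (F : algebra S) (w : S) (t : 'I_(arity w) -> F) :
  complex_op (fun i => fin1 (t i)) = fin1 (app F w t).
Proof.
apply: fin_subset_eq; apply/seteqP; split=> [_ [s Hs <-]|_ ->] /=; last by exists t.
by congr (app F w _); apply/funext.
Qed.

Lemma is_hom_fin1 (S : signature) (F : algebra S) (A : add_algebra S)
    (g : power_algebra F -> A) :
  is_add_hom g -> is_hom (fun x => g (fin1 x)).
Proof.
move=> [[g1 gM] _]; split=> // w t.
by rewrite -complex_op_fin1; apply: (gM w (fun i => fin1 (t i))).
Qed.

Lemma add_hom_ext (S : signature) (F : algebra S) (A : add_algebra S)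
    (g g' : power_algebra F -> A) :
  is_add_hom g -> is_add_hom g' ->
  (forall x, g (fin1 x) = g' (fin1 x)) -> g = g'.
Proof.
move=> [_ gU] [_ gU'] gg'; apply/funext; elim/fin_subset_ind => // x B IHB.
by have := gU (fin1 x) B; have := gU' (fin1 x) B => /= -> ->; rewrite gg' IHB.
Qed.

Lemma power_extension (S : signature) (F : algebra S) (A : add_algebra S)
    (k : F -> A) :
  is_semilattice (add A) -> distributes A -> is_hom k ->
  exists g : power_algebra F -> A,
    is_add_hom g /\ forall x, g (fin1 x) = k x.
Proof.
move=> addP appD [k1 kM].
have /choice [g Hg] := fun B : fin_subset F => is_sup_exists addP B k.
have g_fin1 x : g (fin1 x) = k x := is_sup_unique addP (Hg _) (is_sup1 _ _ _).
exists g; split=> //; split; last first.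
  by move=> B C; apply: (is_sup_unique addP (Hg _)); apply: is_supU.
split=> [|w B]; first by rewrite g_fin1.
apply: (is_sup_unique addP (Hg _)) => u.
apply: iff_trans (app_is_sup addP appD (fun i => Hg (B i)) u) _.
by split=> [H _ [t Bt <-]|H t Bt]; [rewrite kM; apply: H | rewrite -kM; apply: H; exists t].
Qed.

Theorem corollary4p3 (S : signature) (V : algebra S -> Prop)
    (hV : unital_variety V)
    (X : Type) (F : algebra S) (eta : X -> F) (hF : is_free V eta)
    (A : add_algebra S) (hA : semilattice_ordered V A) (h : X -> A) :
  exists! g : power_algebra F -> A,
    is_add_hom g /\ forall x : X, g (fin1 (eta x)) = h x.
Proof.
have [VA addP appD] := hA; have [_ /(_ A VA h) [k [[kH kh] k_uniq]]] := hF.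
have [g [gH gk]] := power_extension addP appD kH.
exists g; split=> [|g' [gH' gh']]; first by split=> // x; rewrite gk.
apply: add_hom_ext => // x; rewrite gk.
by rewrite (k_uniq (fun x => g' (fin1 x))) //; split=> //; apply: is_hom_fin1.
Qed.
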